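(* Let $m$ be a positive integer and $d\in\mathbb{Z}$. The set $\mathcal{A}_{d,m}$ is $s$-square universal for some $s\in\mathbb{N}$ if and only if $d\equiv \pm 1\pmod m$. Furthermore, if $m\ge 2$ and $d\equiv\pm1\pmod m$, then \[ \mathrm{SU}(\mathcal{A}_{d,m})=\begin{cases} 10 & \text{if } m=2,4,\\ 6 & \text{if } m=3,\\ 16 & \text{if } m=5,\\ 26 & \text{if } m=6,\\ m^2-2m & \text{if } m\ge 7. \end{cases} \]
   Context: For a positive integer $m$ and $d\in\mathbb{Z}$, $\mathcal{A}_{d,m}=\{mx+d : x\in\mathbb{Z}\}$ denotes the residue class of $d$ modulo $m$. For $s\in\mathbb{N}$, a subset $\mathcal{A}\subseteq\mathbb{Z}$ is called $s$-square universal if every positive integer can be written as a sum of at most $s$ squares of integers from $\mathcal{A}$ (repetitions allowed). The minimal such $s$, if it exists, is denoted by $\mathrm{SU}(\mathcal{A})$. *)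

(* Defs.v *)
From mathcomp Require Import all_boot all_order all_algebra.
From mathcomp Require Import boolp classical_sets.

Set Implicit Arguments.
Unset Strict Implicit.
Unset Printing Implicit Defensive.

Import Order.TTheory GRing.Theory Num.Theory.
Local Open Scope classical_set_scope.
Local Open Scope ring_scope.

Definition residue_class (d : int) (m : nat) : set int :=
  [set m%:Z * x + d | x in [set: int]].

(* xs lists the integers being squared; as it is a sequence, repetitions are
   allowed. *)
Definition square_universal (s : nat) (A : set int) : Prop :=
  forall n : int, 0 < n ->
    exists xs : seq int,
      [/\ (size xs <= s)%N,
          (forall a, a \in xs -> A a) &
          n = \sum_(a <- xs) a ^+ 2].

(* SU(A) exists and equals s.  It is a relation because SU(A) is only
   partially defined. *)
Definition is_SU (A : set int) (s : nat) : Prop :=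
  square_universal s A /\ forall t : nat, square_universal t A -> (s <= t)%N.

(* Main.v *)
Require Import Defs.
From mathcomp Require Import all_boot all_order all_algebra.
From mathcomp Require Import boolp classical_sets.
From mathcomp Require Import zify ring.

(** If [1] is a sum of squares from the class of [d] modulo [m], then [1] or
    [-1] lies in the class; conversely, when [d = 1] or [d = -1] modulo [m], the
    squares from the class are the numbers [(m y + 1) ^ 2], so that a sum of [k]
    of them is [k + m (m a + 2 b)] with [a] the sum of the [y ^ 2] and [b] the
    sum of the [y].

    Everything rests on Gauss's theorem that each [N = 3] modulo [8] is a sum of
    three odd squares ([three_odd_squares]).  Cauchy's lemma
    ([four_squares_sum]) follows: if [a], [b] are odd and [b ^ 2 < 4 a], then
    [4 a - b ^ 2] is a sum of three odd squares, and a linear substitution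
    gives four integers with sum [b] and sum of squares [a].  Hence four terms
    reach [4 + m (m a + 2 b)] for all such [a], [b].

    - For [m >= 7] write [n = s + m N] with [1 <= s <= m].  If [N <= m - 3], ones
      are enough, and for [N = m - 2] one uses [(m - 1) ^ 2] and ones.  Otherwise
      some [N - j] with [1 <= j <= m - 3] has the form [m q + 2 b] with [q >= 1]
      and small [b], because such numbers have no larger gaps; filling up with
      ones gives [s + j m <= m ^ 2 - 2 m] terms.  The number
      [m ^ 2 - 2 m] itself is below [(m - 1) ^ 2], so only ones can be used for it.
    - For [m = 5] the same idea works with [b] up to [5], apart from finitely
      many [n] that are checked by computation; [31] needs [16] terms.
    - For [m = 2, 4, 6] the number of terms is determined modulo [8], [8], [24]
      by [n].  All residues [3], [4], ... are served by three squares and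
      additional ones, and [42], resp. [266], is not a sum of two squares.  The
      odd squares also settle the existence of [s] for [m = 1].
    - For [m = 3] every [n = 1] modulo [3] with [n >= 4] is a sum of four squares
      prime to [3], and [15] is not a sum of three.

    Gauss's theorem is obtained from a recurrence.  Let [t N] count the odd
    positive solutions of [x ^ 2 + y ^ 2 + z ^ 2 = N], and [f N] those of
    [x y + y z + z x = N]; here [(1, 1, (N - 1) / 2)] is a solution.  Both counts
    satisfy, for [K] odd, [\sum_(w odd) (K - w ^ 2) c (4 K - w ^ 2) = 0], and this
    determines [c] on the class [3] modulo [8] up to a factor.
    For [t] the recurrence is the symmetry between [x], [y], [z] and [w].  For
    [f], the solutions of [x y + y z + z x + w ^ 2 = 4 K] are read as integer
    matrices [[v, -c; a, u]] of determinant [K] whose fixed point in the upper half-plane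
    lies in an ideal triangle ([reduced]); [w] is the trace.  The weight
    [w ^ 2 - K] is the sum of [v (v + a)] over the three rotations of the
    triangle ([turn]), and [v (v + a)] is negated by an involution of the set of
    these matrices ([flip]). *)

Set Implicit Arguments.
Unset Strict Implicit.
Unset Printing Implicit Defensive.

Import Order.TTheory GRing.Theory Num.Theory.
Local Open Scope ring_scope.

(** * Counting odd solutions of ternary equations *)

Definition cube (B : nat) : seq (nat * nat * nat) :=
  [seq (xy, z) | xy <- [seq (x, y) | x <- iota 0 B, y <- iota 0 B],
                 z <- iota 0 B].

Lemma mem_cube (B x y z : nat) :
  ((x, y, z) \in cube B) = [&& x < B, y < B & z < B]%N.
Proof.
apply/allpairsP/idP => [[[[x' y'] z'] /=]|/and3P[xB yB zB]].
  case=> /allpairsP[[x'' y''] /= []].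
  rewrite !mem_iota => /= xB yB [-> ->] zB [-> -> ->].
  by rewrite xB yB zB.
exists (x, y, z); split => //=; last by rewrite mem_iota.
by apply/allpairsP; exists (x, y); rewrite !mem_iota.
Qed.

Lemma allpairs_pair_uniq (S T : eqType) (s : seq S) (t : seq T) :
  uniq s -> uniq t -> uniq [seq (x, y) | x <- s, y <- t].
Proof. by move=> us ut; apply: allpairs_uniq => // -[x y] [x1 y1] _ _ /= [-> ->]. Qed.

Lemma cube_uniq (B : nat) : uniq (cube B).
Proof. by rewrite !allpairs_pair_uniq ?iota_uniq. Qed.

Definition odd_triple (t : nat * nat * nat) : bool :=
  [&& odd t.1.1, odd t.1.2 & odd t.2].

Definition odd_count (Q : nat * nat * nat -> nat) (B N : nat) : int :=
  \sum_(t <- cube B | odd_triple t && (Q t == N)) 1.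

(** The bound [B] only makes the set finite: in what follows [M < B], so that it
    excludes no solution. *)
Definition quads (Q : nat * nat * nat -> nat) (B M : nat) :
    seq (nat * nat * nat * nat) :=
  [seq q <- [seq (t, w) | t <- cube B, w <- iota 0 B] |
    [&& odd_triple q.1, odd q.2 & Q q.1 + q.2 ^ 2 == M]%N].

Lemma quads_uniq Q B M : uniq (quads Q B M).
Proof. by rewrite filter_uniq // allpairs_pair_uniq ?cube_uniq ?iota_uniq. Qed.

Lemma mem_quads Q B M x y z w :
  ((x, y, z, w) \in quads Q B M) =
  [&& [&& x < B, y < B, z < B & w < B], [&& odd x, odd y, odd z & odd w] &
      Q (x, y, z) + w ^ 2 == M]%N.
Proof.
have mem_box : ((x, y, z, w) \in [seq (t, w) | t <- cube B, w <- iota 0 B]) =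
    ((x, y, z) \in cube B) && (w < B)%N.
  apply/allpairsP/idP => [[[t w'] /= [tB]]|/andP[tB wB]].
    by rewrite mem_iota => wB [-> ->]; rewrite tB.
  by exists (x, y, z, w); rewrite mem_iota.
rewrite mem_filter mem_box mem_cube /odd_triple /= -!andbA.
by do !bool_congr; rewrite andbC -!andbA; do !bool_congr.
Qed.

Lemma sum_quads Q B M (F : nat -> int) : (M < B)%N ->
  \sum_(q <- quads Q B M) F q.2 =
  \sum_(w <- iota 0 B | odd w && (w ^ 2 <= M)%N)
     F w * odd_count Q B (M - w ^ 2).
Proof.
move=> MB; rewrite big_filter big_mkcond big_allpairs exchange_big /=.
rewrite [RHS]big_mkcond /=; apply: eq_bigr => w _.
case: ifP => [/andP[ow wM]|nw].
  rewrite /odd_count big_distrr /= [RHS]big_mkcond /=.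
  apply: eq_bigr => t _; rewrite ow /= mulr1.
  have -> : (Q t + w ^ 2 == M)%N = (Q t == M - w ^ 2)%N by lia.
  by [].
rewrite big1 // => t _; case: ifP => // /and3P[_ ow /eqP e].
by move: nw; rewrite ow -e leq_addl.
Qed.

Lemma odd_sqr_mod8 w : odd w -> (w ^ 2 %% 8 = 1)%N.
Proof.
move=> ow; have -> : w = (w %/ 2 * 2 + 1)%N by lia.
have -> : ((w %/ 2 * 2 + 1) ^ 2 = 4 * (w %/ 2 * (w %/ 2).+1) + 1)%N by ring.
by have := oddM (w %/ 2) (w %/ 2).+1; rewrite /= andbN; lia.
Qed.

(** Comparing two ternary counts through a common recurrence: the term [w = 1]
    has the nonzero coefficient [K - 1], so the recurrence at [K] expresses the
    count at [4K - 1] by the counts at smaller arguments. *)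
Lemma odd_count_proportional Q1 Q2 B :
  (forall K, odd K -> (4 * K < B)%N ->
    \sum_(q <- quads Q1 B (4 * K)) (K%:Z - (q.2 ^ 2)%N%:Z) = 0) ->
  (forall K, odd K -> (4 * K < B)%N ->
    \sum_(q <- quads Q2 B (4 * K)) (K%:Z - (q.2 ^ 2)%N%:Z) = 0) ->
  forall N, (N %% 8 = 3)%N -> (N.+1 < B)%N ->
  odd_count Q1 B N * odd_count Q2 B 3 = odd_count Q2 B N * odd_count Q1 B 3.
Proof.
move=> rec1 rec2; elim/ltn_ind => N IH N8 NB.
have [N3|N3] := eqVneq N 3%N; first by rewrite N3 mulrC.
pose K := (N.+1 %/ 4)%N.
have K4 : (4 * K = N.+1)%N by rewrite /K; lia.
have oK : odd K by lia.
have KB : (4 * K < B)%N by lia.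
have K1 : K%:Z - 1 != 0 by lia.
have split1 Q : \sum_(q <- quads Q B (4 * K)) (K%:Z - (q.2 ^ 2)%N%:Z) =
    (K%:Z - 1) * odd_count Q B N +
    \sum_(w <- iota 0 B | odd w && (w ^ 2 <= 4 * K)%N && (w != 1%N))
      (K%:Z - (w ^ 2)%N%:Z) * odd_count Q B (4 * K - w ^ 2).
  rewrite (@sum_quads _ _ _ (fun w => K%:Z - (w ^ 2)%N%:Z)) //.
  rewrite -[LHS]big_filter (bigD1_seq 1%N) ?filter_uniq ?iota_uniq //=; last first.
    by rewrite mem_filter mem_iota; lia.
  by rewrite big_filter_cond exp1n (_ : (4 * K - 1)%N = N) //; lia.
have := rec1 K oK KB; rewrite split1 => /eqP; rewrite addr_eq0 => /eqP e1.
have := rec2 K oK KB; rewrite split1 => /eqP; rewrite addr_eq0 => /eqP e2.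
apply: (mulfI K1); rewrite !mulrA e1 e2 !mulNr; congr (- _).
rewrite !big_distrl /=; apply: eq_bigr => w /andP[/andP[ow wK] w1].
rewrite -!mulrA; congr (_ * _).
have w3 : (3 ^ 2 <= w ^ 2)%N.
  by rewrite leq_sqr; move: w1 ow; case: w {wK} => [|[|[|]]].
have := odd_sqr_mod8 ow; set w2 := (w ^ 2)%N in w3 wK *.
by move=> w8; apply: IH; lia.
Qed.

(** * The recurrence for sums of three odd squares *)

Lemma sum_reindex_stable (T : eqType) (s : seq T) (g : T -> T) (F : T -> int) :
  uniq s -> {in s, forall x, g x \in s} -> {in s &, injective g} ->
  \sum_(x <- s) F (g x) = \sum_(x <- s) F x.
Proof.
move=> us gs gI; have ug : uniq (map g s) by rewrite map_inj_in_uniq.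
have sub : {subset map g s <= s} by move=> y /mapP[x xs ->]; apply: gs.
have [_ eq_mem] := uniq_min_size ug sub (eq_leq (esym (size_map g s))).
by rewrite -(big_map g xpredT F); apply: perm_big; apply: uniq_perm.
Qed.

Definition squares3 (t : nat * nat * nat) : nat :=
  (t.1.1 ^ 2 + t.1.2 ^ 2 + t.2 ^ 2)%N.

Definition products3 (t : nat * nat * nat) : nat :=
  (t.1.1 * t.1.2 + t.1.2 * t.2 + t.2 * t.1.1)%N.

(** The four unknowns play the same role, so [w ^ 2] has the same sum as
    [(x ^ 2 + y ^ 2 + z ^ 2 + w ^ 2) / 4 = K]. *)
Lemma squares3_recurrence B K :
  \sum_(q <- quads squares3 B (4 * K)) (K%:Z - (q.2 ^ 2)%N%:Z) = 0.
Proof.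
set s := quads _ _ _.
pose rot4 (q : nat * nat * nat * nat) := (q.1.1.2, q.1.2, q.2, q.1.1.1).
have rot_s : {in s, forall q, rot4 q \in s}.
  move=> [[[x y] z] w]; rewrite !mem_quads /squares3 /=.
  move=> /and3P[/and4P[-> -> -> ->] /and4P[-> -> -> ->] /eqP <-].
  by apply/eqP; rewrite /= addnC !addnA.
have rotI : {in s &, injective rot4}.
  by move=> [[[x y] z] w] [[[x' y'] z'] w'] _ _ /= [-> -> -> ->].
have rotE (F : _ -> int) := sum_reindex_stable F (quads_uniq _ _ _ : uniq s) rot_s rotI.
pose G (q : nat * nat * nat * nat) := (q.2 ^ 2)%N%:Z.
pose S := \sum_(q <- s) G q.
have sum4 : \sum_(q <- s) ((squares3 q.1 + q.2 ^ 2)%N%:Z) = 4 * S.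
  have Sx : \sum_(q <- s) (q.1.1.1 ^ 2)%N%:Z = S := rotE G.
  have Sy : \sum_(q <- s) (q.1.1.2 ^ 2)%N%:Z = S.
    by rewrite -Sx -(rotE (fun q => (q.1.1.1 ^ 2)%N%:Z)).
  have Sz : \sum_(q <- s) (q.1.2 ^ 2)%N%:Z = S.
    by rewrite -Sy -(rotE (fun q => (q.1.1.2 ^ 2)%N%:Z)).
  have -> : 4 * S = S + S + S + S by ring.
  rewrite -{1}Sx -{1}Sy -{1}Sz /S -!big_split /=.
  by apply: eq_bigr => -[[[x y] z] w] _; rewrite /G /squares3 /= !PoszD.
have: \sum_(q <- s) ((squares3 q.1 + q.2 ^ 2)%N%:Z) = \sum_(q <- s) (4 * K)%:Z.
  rewrite big_seq [RHS]big_seq; apply: eq_bigr => -[[[x y] z] w].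
  by rewrite mem_quads => /and3P[_ _ /eqP ->].
have -> : \sum_(q <- s) (4 * K)%:Z = 4 * \sum_(q <- s) K%:Z.
  by rewrite big_distrr /=; apply: eq_bigr => q _; rewrite PoszM.
rewrite sum4 sumrB => /(mulfI (isT : 4 != 0 :> int)) <-.
by rewrite subrr.
Qed.

(** * The recurrence for [x y + y z + z x] *)

(** The matrix [[v, -c; a, u]] has determinant [K], is of order three modulo
    [2], and fixes a root of [a X ^ 2 + (u - v) X + c].  The three inequalities
    say that [x = u - v], [y = 2 c - x] and [z = 2 a - x] are positive, which
    puts that root into the ideal triangle with vertices [-1], [0] and infinity.
    With [w = u + v] the determinant is a quarter of
    [x y + y z + z x + w ^ 2]. *)
Definition reduced (K : nat) (m : int * int * int * int) : bool :=
  let: (a, c, u, v) := m in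
  [&& [&& (a %% 2 == 1)%Z, (c %% 2 == 1)%Z, (u %% 2 == 1)%Z & (v %% 2 == 0)%Z],
      [&& v < u, u - v < 2 * a & u - v < 2 * c] & a * c + u * v == K].

(** The sign of [w] is chosen so that [w = x] modulo [4]; then [v] is even. *)
Definition mx_of_quad (q : nat * nat * nat * nat) : int * int * int * int :=
  let: (x, y, z, w) := q in
  let s := if ((w%:Z - x%:Z) %% 4 == 0)%Z then w%:Z else - w%:Z in
  (((x%:Z + z%:Z) %/ 2)%Z, ((x%:Z + y%:Z) %/ 2)%Z, ((s + x%:Z) %/ 2)%Z, ((s - x%:Z) %/ 2)%Z).

Definition quad_of_mx (m : int * int * int * int) : nat * nat * nat * nat :=
  let: (a, c, u, v) := m in
  (absz (u - v), absz (2 * c - u + v), absz (2 * a - u + v), absz (u + v)).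

(** With [x = 2 i + 1] and so on, the equation divided by [4] shows that
    [i j + j k + k i + i + j + k] is even, which forces [i], [j], [k] to have the
    same parity.  This is what makes the entries of [mx_of_quad] integral and
    gives them the right parities. *)
Lemma products3_mod4 K x y z w :
  odd K -> odd x -> odd y -> odd z -> odd w ->
  (products3 (x, y, z) + w ^ 2 = 4 * K)%N ->
  (y %% 4 = x %% 4)%N /\ (z %% 4 = x %% 4)%N.
Proof.
move=> oK ox oy oz ow; rewrite /products3 /=.
have := odd_sqr_mod8 ow.
have -> : x = (x %/ 2 * 2 + 1)%N by lia.
have -> : y = (y %/ 2 * 2 + 1)%N by lia.
have -> : z = (z %/ 2 * 2 + 1)%N by lia.
move: (x %/ 2)%N (y %/ 2)%N (z %/ 2)%N => i j k w8 e.
have : ~~ odd (i * j + j * k + k * i + i + j + k).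
  move: e; have -> : ((i * 2 + 1) * (j * 2 + 1) + (j * 2 + 1) * (k * 2 + 1) +
     (k * 2 + 1) * (i * 2 + 1) = 4 * (i * j + j * k + k * i + i + j + k) + 3)%N.
    by ring.
  by lia.
rewrite !oddD !oddM.
by case oi: (odd i); case oj: (odd j); case ok: (odd k) => //= _; lia.
Qed.

Lemma mx_of_quadK B K :
  odd K -> {in quads products3 B (4 * K), cancel mx_of_quad quad_of_mx}.
Proof.
move=> oK [[[x y] z] w]; rewrite mem_quads.
move=> /and3P[_ /and4P[ox oy oz ow] /eqP e].
have [y4 z4] := products3_mod4 oK ox oy oz ow e.
rewrite /mx_of_quad; case: ifP => w4 /=; do ![congr (_, _)]; lia.
Qed.

Lemma mx_of_quad_reduced B K :
  odd K -> {in quads products3 B (4 * K), forall q, reduced K (mx_of_quad q)}.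
Proof.
move=> oK [[[x y] z] w]; rewrite mem_quads.
move=> /and3P[_ /and4P[ox oy oz ow] /eqP e].
have [y4 z4] := products3_mod4 oK ox oy oz ow e.
rewrite /mx_of_quad; set s : int := if _ then _ else _.
have s4 : ((s - x%:Z) %% 4)%Z = 0 by rewrite /s; case: ifP; lia.
have s2 : s ^+ 2 = w%:Z ^+ 2 by rewrite /s; case: ifP => _; rewrite ?sqrrN.
set a := ((x%:Z + z%:Z) %/ 2)%Z; set c := ((x%:Z + y%:Z) %/ 2)%Z.
set u := ((s + x%:Z) %/ 2)%Z; set v := ((s - x%:Z) %/ 2)%Z.
have ea : 2 * a = x%:Z + z%:Z by rewrite /a; lia.
have ec : 2 * c = x%:Z + y%:Z by rewrite /c; lia.
have eu : 2 * u = s + x%:Z by rewrite /u; lia.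
have ev : 2 * v = s - x%:Z by rewrite /v; lia.
apply/and3P; split; [by rewrite /a /c /u /v; lia | by lia |].
apply/eqP/(mulfI (isT : 4 != 0 :> int)).
have -> : 4 * (a * c + u * v) = (2 * a) * (2 * c) + (2 * u) * (2 * v) by ring.
rewrite ea ec eu ev; have -> : 4 * K%:Z = (4 * K)%N%:Z by rewrite PoszM.
have -> : (x%:Z + z%:Z) * (x%:Z + y%:Z) + (s + x%:Z) * (s - x%:Z) =
  x%:Z * y%:Z + y%:Z * z%:Z + z%:Z * x%:Z + s ^+ 2 by ring.
by rewrite s2 -e /products3 /= !PoszD !PoszM.
Qed.

Lemma mem_mx_of_quads B K m :
  odd K -> (4 * K < B)%N ->
  (m \in map mx_of_quad (quads products3 B (4 * K))) = reduced K m.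
Proof.
move=> oK KB; apply/mapP/idP => [[q qB ->]|]; first exact: mx_of_quad_reduced qB.
move: m => [[[a c] u] v] /and3P[/and4P[/eqP a2 /eqP c2 /eqP u2 /eqP v2]].
move=> /and3P[vu ga ba] /eqP e.
exists (quad_of_mx (a, c, u, v)); last first.
  rewrite /quad_of_mx /mx_of_quad; case: ifP => w4; do ![congr (_, _)]; lia.
rewrite mem_quads /products3 /=.
have [x ex] : exists x : nat, x%:Z = u - v by exists (absz (u - v)); lia.
have [y ey] : exists y : nat, y%:Z = 2 * c - u + v.
  by exists (absz (2 * c - u + v)); lia.
have [z ez] : exists z : nat, z%:Z = 2 * a - u + v.
  by exists (absz (2 * a - u + v)); lia.
have eN : (x * y + y * z + z * x + absz (u + v)%R ^ 2)%N = (4 * K)%N.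
  apply/eqP; rewrite -eqz_nat -mulnn !PoszD !PoszM.
  have -> : (absz (u + v))%:Z * (absz (u + v))%:Z = (u + v) * (u + v).
    by rewrite -!expr2 abszE real_normK ?num_real.
  by rewrite ex ey ez -e; apply/eqP; ring.
rewrite -ex -ey -ez !absz_nat.
apply/and3P; split; [|by lia|by apply/eqP].
have x0 : (0 < x)%N by lia. have y0 : (0 < y)%N by lia.
have z0 : (0 < z)%N by lia.
have w0 : (0 < absz (u + v)%R)%N by lia.
move: eN; set w := absz _ in w0 *; rewrite -mulnn.
by move: KB x0 y0 z0 w0; clear; move: w => w *; apply/and4P; split; nia.
Qed.

(** The first column [(v, a)] of a reduced matrix is sent to [(- v, a + 2 v)], up
    to a sign that makes the lower entry positive; this is an involution on
    columns and negates [v (v + a)].  The second column is carried along and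
    then corrected by an even multiple of the first one, so that [u - v] comes to
    lie between [0] and [2 a]: this fixes it, given the first column. *)
Definition flip (K : nat) (m : int * int * int * int) : int * int * int * int :=
  let: (a, c, u, v) := m in
  let e : int := if 0 < a + 2 * v then 1 else -1 in
  let a1 := e * (a + 2 * v) in
  let v1 := - (e * v) in
  let u1 := v1 + ((e * (2 * c - u) - v1) %% (2 * a1))%Z in
  (a1, ((K%:Z - u1 * v1) %/ a1)%Z, u1, v1).

(** The multiple [t] of the first column that is needed has a definite sign.
    Before the correction, the difference [u - v] of the new matrix is
    [y = 2 c - u + v], resp. [- y], and [y > 0]. *)
Lemma flip_spec K a c u v : reduced K (a, c, u, v) ->
  (exists t, [/\ 0 < a + 2 * v, t <= 0, 2 * c - u + v + 2 * (a + 2 * v) * t > 0,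
     2 * c - u + v + 2 * (a + 2 * v) * t < 2 * (a + 2 * v) &
     flip K (a, c, u, v) =
       (a + 2 * v, c + 2 * t * v, 2 * c - u + 2 * (a + 2 * v) * t, - v)]) \/
  (exists t, [/\ a + 2 * v < 0, 0 < t, u - 2 * c - v - 2 * (a + 2 * v) * t > 0,
     u - 2 * c - v - 2 * (a + 2 * v) * t < - (2 * (a + 2 * v)) &
     flip K (a, c, u, v) =
       (- (a + 2 * v), - c - 2 * t * v, u - 2 * c - 2 * (a + 2 * v) * t, v)]).
Proof.
move=> /and3P[/and4P[/eqP a2 /eqP c2 /eqP u2 /eqP v2] /and3P[vu ga ba] /eqP eK].
rewrite /flip; have [b0|b0] := ltP 0 (a + 2 * v); [left|right].
  rewrite !mul1r; set b := a + 2 * v in b0 *.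
  have eb : b = a + 2 * v by [].
  set d := 2 * c - u - - v; pose t := - (d %/ (2 * b))%Z; exists t.
  have er : (d %% (2 * b))%Z = d + 2 * b * t.
    by have := divz_eq d (2 * b); rewrite /t; lia.
  have rb : (d %% (2 * b))%Z < 2 * b by apply: ltz_pmod; lia.
  have r0 : 0 <= (d %% (2 * b))%Z by apply: modz_ge0; lia.
  have r1 : (d %% (2 * b))%Z != 0.
    by rewrite er; move: (b * t) (mulrA 2 b t) => bt <-; rewrite /d; lia.
  rewrite er in rb r0 r1 *.
  have ec : K%:Z - (- v + (d + 2 * b * t)) * - v = (c + 2 * t * v) * b.
    by rewrite -eK /d eb; ring.
  have t0 : t <= 0.
    rewrite leNgt; apply/negP => t0.
    have : b <= b * t by rewrite ler_peMr //; lia.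
    by move: rb; rewrite /d -mulrA; lia.
  split=> //; [by move: r0 r1; rewrite /d -!mulrA; lia|by move: rb; rewrite /d -!mulrA; lia|].
  rewrite ec mulzK ?gt_eqF //; do ![congr (_, _)].
  by rewrite /d; ring.
have {}b0 : a + 2 * v < 0 by lia.
rewrite !mulN1r opprK; set b := a + 2 * v in b0 *.
have eb : b = a + 2 * v by [].
set d := - (2 * c - u) - v; pose t := - (d %/ (2 * - b))%Z; exists t.
have er : (d %% (2 * - b))%Z = d - 2 * b * t.
  by have := divz_eq d (2 * - b); rewrite /t; lia.
have rb : (d %% (2 * - b))%Z < 2 * - b by apply: ltz_pmod; lia.
have r0 : 0 <= (d %% (2 * - b))%Z by apply: modz_ge0; lia.
have r1 : (d %% (2 * - b))%Z != 0.
  by rewrite er; move: (b * t) (mulrA 2 b t) => bt <-; rewrite /d; lia.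
rewrite er in rb r0 r1 *.
have ec : K%:Z - (v + (d - 2 * b * t)) * v = (- c - 2 * t * v) * - b.
  by rewrite -eK /d eb; ring.
have t0 : 0 < t.
  rewrite ltNge; apply/negP => t0.
  have : 0 <= b * t by rewrite mulr_le0 //; lia.
  by move: r0; rewrite /d -mulrA; lia.
split=> //; [by move: r0 r1; rewrite /d -!mulrA; lia|by move: rb; rewrite /d -!mulrA; lia|].
rewrite ec mulzK; last by lia.
by do ![congr (_, _)]; rewrite /d; ring.
Qed.

(** Only [u - v < 2 c] needs an argument.  In terms of the old entries the new
    value of [2 c - u + v] is [x - 2 a t], resp. [2 a t - x], where
    [0 < x < 2 a] for [x = u - v]; the sign of [t] makes it positive. *)
Lemma flip_reduced K m : reduced K m -> reduced K (flip K m).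
Proof.
move: m => [[[a c] u] v] red.
move: (red) => /and3P[/and4P[/eqP a2 /eqP c2 /eqP u2 /eqP v2]].
move=> /and3P[vu ga ba] /eqP eK.
case: (flip_spec red) => -[t [b0 t0 lo hi ->]]; apply/and3P; split.
- by move: (t * v) (mulrA 2 t v) (mulrA 2 (a + 2 * v) t) => tv <- <-; lia.
- have : a * t <= 0 by nia.
  have -> : 2 * (a + 2 * v) * t = 2 * (a * t) + 4 * (t * v) by ring.
  by move: lo hi; lia.
- by apply/eqP; rewrite -eK; ring.
- by move: (t * v) (mulrA 2 t v) (mulrA 2 (a + 2 * v) t) => tv <- <-; lia.
- have : a <= a * t by nia.
  by move: lo hi; lia.
- by apply/eqP; rewrite -eK; ring.
Qed.

(** Flipping twice restores the first column and changes [u] by a multiple of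
    [2 a], which is zero since [u - v] determines it. *)
Lemma flipK K m : reduced K m -> flip K (flip K m) = m.
Proof.
move: m => [[[a c] u] v] red.
move: (red) => /and3P[_ /and3P[vu ga ba] /eqP eK].
have a0 : a != 0 by lia.
have uv2a : ((u - v) %% (2 * a))%Z = u - v by rewrite modz_small //; lia.
have uvE : v + (u - v) = u by rewrite addrC subrK.
have cE : ((K%:Z - u * v) %/ a)%Z = c by rewrite -eK addrK mulrC mulzK.
case: (flip_spec red) => -[t [b0 t0 lo hi ->]]; rewrite /flip.
  have -> : a + 2 * v + 2 * - v = a by ring.
  have -> : 0 < a by lia.
  rewrite !mul1r opprK.
  have -> : 2 * (c + 2 * t * v) - (2 * c - u + 2 * (a + 2 * v) * t) - v =
    - t * (2 * a) + (u - v) by ring.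
  by rewrite modzMDl uv2a uvE cE.
have -> : - (a + 2 * v) + 2 * v = - a by ring.
have -> : (0 < - a) = false by lia.
rewrite !mulN1r !opprK.
have -> : - (2 * (- c - 2 * t * v) - (u - 2 * c - 2 * (a + 2 * v) * t)) - v =
    - t * (2 * a) + (u - v) by ring.
by rewrite modzMDl uv2a uvE cE.
Qed.

Definition corner (m : int * int * int * int) : int :=
  let: (a, c, u, v) := m in v * (v + a).

Lemma corner_flip K m : reduced K m -> corner (flip K m) = - corner m.
Proof.
move: m => [[[a c] u] v] red.
by case: (flip_spec red) => -[t [_ _ _ _ ->]]; rewrite /corner; ring.
Qed.

(** Conjugation by the rotation of order three of the ideal triangle: it permutes
    [u - v], [2 c - u + v] and [2 a - u + v] cyclically and keeps [u + v]. *)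
Definition turn (m : int * int * int * int) : int * int * int * int :=
  let: (a, c, u, v) := m in (c, a + c - u + v, c + v, u - c).

Lemma turn_reduced K m : reduced K m -> reduced K (turn m).
Proof.
move: m => [[[a c] u] v] /and3P[/and4P[/eqP a2 /eqP c2 /eqP u2 /eqP v2]].
move=> /and3P[vu ga ba] /eqP eK.
apply/and3P; split; [by lia|by lia|apply/eqP; rewrite -eK; ring].
Qed.

Lemma turn_inj : injective turn.
Proof.
move=> [[[a c] u] v] [[[a' c'] u'] v'] /= [-> e1 e2 e3].
by do ![congr (_, _)]; lia.
Qed.

(** Summed over the three rotations of a matrix, [corner] gives [w ^ 2 - K]; its
    sum over all reduced matrices is its own opposite because of [flip]. *)
Lemma products3_recurrence B K : odd K -> (4 * K < B)%N ->
  \sum_(q <- quads products3 B (4 * K)) (K%:Z - (q.2 ^ 2)%N%:Z) = 0.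
Proof.
move=> oK KB; set E := map mx_of_quad (quads products3 B (4 * K)).
have memE m : (m \in E) = reduced K m := mem_mx_of_quads m oK KB.
have uE : uniq E.
  by rewrite map_inj_in_uniq ?quads_uniq //; exact: can_in_inj (mx_of_quadK oK).
have E0 : \sum_(m <- E) corner m = 0.
  have flipE : \sum_(m <- E) corner (flip K m) = \sum_(m <- E) corner m.
    apply: (sum_reindex_stable corner uE) => [m|m1 m2]; rewrite !memE.
      exact: flip_reduced.
    by move=> r1 r2 e; rewrite -(flipK r1) e flipK.
  have : \sum_(m <- E) corner (flip K m) = - \sum_(m <- E) corner m.
    rewrite -sumrN big_seq [RHS]big_seq; apply: eq_bigr => m.
    by rewrite memE; apply: corner_flip.
  by rewrite flipE; lia.
have turnE (F : int * int * int * int -> int) : \sum_(m <- E) F (turn m) = \sum_(m <- E) F m.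
  apply: (sum_reindex_stable F uE) => [m|m1 m2 _ _]; last exact: turn_inj.
  by rewrite !memE; apply: turn_reduced.
have : \sum_(m <- E) (corner m + corner (turn m) + corner (turn (turn m))) = 0.
  by rewrite !big_split /= (turnE (corner \o turn)) (turnE corner) E0.
rewrite big_map => e; apply: oppr_inj; rewrite oppr0 -[RHS]e -sumrN.
rewrite big_seq [RHS]big_seq; apply: eq_bigr => q qE.
have := mx_of_quadK oK qE; have := mx_of_quad_reduced oK qE.
case: (mx_of_quad q) => [[[a c] u] v] /and3P[_ _ /eqP <-] <-.
rewrite /quad_of_mx /corner /turn /= -mulnn PoszM.
by rewrite -expr2 abszE real_normK ?num_real //; ring.
Qed.

(** * Three squares and four squares *)

(** Gauss's theorem.  The solution [(1, 1, (N - 1) / 2)] shows that the count for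
    [x y + y z + z x = N] does not vanish. *)
Theorem three_odd_squares N : (N %% 8 = 3)%N ->
  exists x y z, [/\ odd x, odd y, odd z & (x ^ 2 + y ^ 2 + z ^ 2 = N)%N].
Proof.
move=> N8.
have pos Q B x y z : odd x -> odd y -> odd z -> (x < B)%N -> (y < B)%N -> (z < B)%N ->
    odd_count Q B (Q (x, y, z)) != 0.
  move=> ox oy oz xB yB zB; rewrite /odd_count -big_filter.
  rewrite (big_rem (x, y, z)) /=; last first.
    by rewrite mem_filter /odd_triple /= ox oy oz eqxx mem_cube xB yB zB.
  by rewrite gt_eqF // ltr_pwDl // sumr_ge0.
pose B := N.+2.
have := @odd_count_proportional squares3 products3 B
  (fun K _ _ => squares3_recurrence B K) (@products3_recurrence B) N N8 (ltnSn _).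
have N1 : products3 (1, 1, N.-1./2)%N = N by rewrite /products3 /=; lia.
move=> e.
have : odd_count squares3 B N * odd_count products3 B 3 != 0.
  rewrite e mulf_neq0 //; last by apply: (pos squares3 B 1 1 1)%N.
  by have := pos products3 B 1%N 1%N N.-1./2; rewrite N1; apply; rewrite /B; lia.
rewrite mulf_eq0 negb_or => /andP[+ _].
rewrite /odd_count -big_filter; case: filter (mem_filter (fun t => odd_triple t && (squares3 t == N)) ^~ (cube B)) => [|[[x y] z] s] h.
  by rewrite big_nil eqxx.
move=> _; have := h (x, y, z); rewrite inE eqxx => /esym/andP[/andP[/and3P[ox oy oz] /eqP e'] _].
by exists x, y, z.
Qed.

(** Cauchy's lemma, without a condition on the signs of the four integers.  If
    [x], [y], [z] are odd with [x ^ 2 + y ^ 2 + z ^ 2 = 4 a - b ^ 2], the sign of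
    [z] can be chosen so that [4] divides [b + x + y + z]; half of an orthogonal
    matrix maps [(b, x, y, z)] to the four integers. *)
Lemma four_squares_sum (a b : int) :
  (a %% 2 = 1)%Z -> (b %% 2 = 1)%Z -> b ^+ 2 < 4 * a ->
  exists x y z w : int,
    x + y + z + w = b /\ x ^+ 2 + y ^+ 2 + z ^+ 2 + w ^+ 2 = a.
Proof.
move=> a2 b2 ba.
have [N eN] : exists N : nat, N%:Z = 4 * a - b ^+ 2.
  by exists (absz (4 * a - b ^+ 2)%R); lia.
have N8 : (N %% 8 = 3)%N.
  have ob : odd (absz b) by lia.
  have := odd_sqr_mod8 ob; have : ((absz b) ^ 2)%N%:Z = b ^+ 2.
    by rewrite -mulnn PoszM -expr2 abszE real_normK ?num_real.
  by move=> eb; rewrite -eb in eN; move: eN; set b2n := (_ ^ 2)%N; lia.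
have [x [y [z [ox oy oz e]]]] := three_odd_squares N8.
have {}e : x%:Z ^+ 2 + y%:Z ^+ 2 + z%:Z ^+ 2 = 4 * a - b ^+ 2.
  by rewrite -eN -e !PoszD -!mulnn !PoszM !expr2.
have [t [ot et]] : exists t : int,
    ((b + x + y + t) %% 4 = 0)%Z /\ t ^+ 2 = z%:Z ^+ 2.
  have [h|h] := eqVneq ((b + x%:Z + y%:Z + z%:Z) %% 4)%Z 0.
    by exists z%:Z.
  by exists (- z%:Z); rewrite sqrrN; split=> //; lia.
pose p := ((b + x%:Z + y%:Z + t) %/ 4)%Z.
pose q := ((b + x%:Z - y%:Z - t) %/ 4)%Z.
pose r := ((b - x%:Z + y%:Z - t) %/ 4)%Z.
pose s := ((b - x%:Z - y%:Z + t) %/ 4)%Z.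
have ep : 4 * p = b + x%:Z + y%:Z + t by rewrite /p; lia.
have eq : 4 * q = b + x%:Z - y%:Z - t by rewrite /q; lia.
have er : 4 * r = b - x%:Z + y%:Z - t by rewrite /r; lia.
have es : 4 * s = b - x%:Z - y%:Z + t by rewrite /s; lia.
exists p, q, r, s; split; first by lia.
apply: (mulfI (isT : 16 != 0 :> int)).
have -> : 16 * (p ^+ 2 + q ^+ 2 + r ^+ 2 + s ^+ 2) =
  (4 * p) ^+ 2 + (4 * q) ^+ 2 + (4 * r) ^+ 2 + (4 * s) ^+ 2 by ring.
have ea : b ^+ 2 + x%:Z ^+ 2 + y%:Z ^+ 2 + t ^+ 2 = 4 * a by rewrite et; lia.
have -> : 16 * a = 4 * (4 * a) by ring.
by rewrite ep eq er es -ea; ring.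
Qed.

Lemma sqr_mod3 (x : int) :
  ((x %% 3)%Z = 0 /\ (x ^+ 2 %% 3)%Z = 0) \/
  ((x %% 3)%Z != 0 /\ (x ^+ 2 %% 3)%Z = 1).
Proof.
have -> : x ^+ 2 = (x %/ 3)%Z * (3 * (x %/ 3)%Z + 2 * (x %% 3)%Z) * 3 + (x %% 3)%Z ^+ 2.
  by rewrite {1}(divz_eq x 3); ring.
rewrite modzMDl.
have : (x %% 3)%Z = 0 \/ (x %% 3)%Z = 1 \/ (x %% 3)%Z = 2 by lia.
by case=> [|[|]] ->; [left|right|right].
Qed.

(** Modulo [3], either none or all of [x], [y], [z] vanish.  In the second case
    [N / 9] is a sum of three squares that do not all vanish modulo [3], by
    induction if [3] divides [N / 9].  Then the integral matrix with rows
    [(1, 2, 2)], [(2, 1, -2)], [(2, -2, 1)], which is three times an orthogonal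
    one, leads back to [N]; modulo [3] its three rows agree up to sign, and the
    signs of [b] and [c] can be chosen so that they map [(a, b, c)] to nonzero
    residues. *)
Lemma three_squares_prime_to3 (N : nat) (x y z : int) :
  (0 < N)%N -> (3 %| N)%N -> x ^+ 2 + y ^+ 2 + z ^+ 2 = N%:Z ->
  exists x' y' z' : int,
    [/\ (x' %% 3)%Z != 0, (y' %% 3)%Z != 0, (z' %% 3)%Z != 0 &
        x' ^+ 2 + y' ^+ 2 + z' ^+ 2 = N%:Z].
Proof.
elim/ltn_ind: N x y z => N IH x y z N0 N3 e.
have [xyz|xyz] := boolP [&& (x %% 3)%Z != 0, (y %% 3)%Z != 0 & (z %% 3)%Z != 0].
  by case/and3P: xyz => hx hy hz; exists x, y, z.
have [[x3 y3] z3] : ((x %% 3)%Z = 0 /\ (y %% 3)%Z = 0) /\ (z %% 3)%Z = 0.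
  move: xyz; case: (sqr_mod3 x) (sqr_mod3 y) (sqr_mod3 z) => -[hx hx2] [] [hy hy2] [] [hz hz2];
  by lia.
have [x1 ex] : exists x1, x = 3 * x1 by exists (x %/ 3)%Z; clear -x3; lia.
have [y1 ey] : exists y1, y = 3 * y1 by exists (y %/ 3)%Z; clear -y3; lia.
have [z1 ez] : exists z1, z = 3 * z1 by exists (z %/ 3)%Z; clear -z3; lia.
have {e} e9 : 9 * (x1 ^+ 2 + y1 ^+ 2 + z1 ^+ 2) = N%:Z.
  by rewrite -e ex ey ez; ring.
have [N' e1] : exists N' : nat, x1 ^+ 2 + y1 ^+ 2 + z1 ^+ 2 = N'%:Z.
  exists (absz (x1 ^+ 2 + y1 ^+ 2 + z1 ^+ 2)%R); rewrite gez0_abs //.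
  by rewrite !addr_ge0 ?sqr_ge0.
have N9 : N%:Z = 9 * N'%:Z by rewrite -e9 e1.
have [N'0 N'N] : (0 < N')%N /\ (N' < N)%N by clear -N9 N0; lia.
clear x y z ex ey ez x3 y3 z3 xyz e9.
have [a [b [c [nz ea]]]] : exists a b c : int,
    ~~ [&& (a %% 3)%Z == 0, (b %% 3)%Z == 0 & (c %% 3)%Z == 0] /\
    a ^+ 2 + b ^+ 2 + c ^+ 2 = N'%:Z.
  have [N3'|N3'] := boolP (3 %| N')%N.
    have [a [b [c [a3 b3 c3 ea]]]] := IH N' N'N x1 y1 z1 N'0 N3' e1.
    by exists a, b, c; split=> //; rewrite (negbTE a3).
  exists x1, y1, z1; split=> //; clear -N3' e1.
  by case: (sqr_mod3 x1) (sqr_mod3 y1) (sqr_mod3 z1) => -[? ?] [] [? ?] [] [? ?]; lia.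
have [b' [c' [nz' eb ec]]] : exists b' c' : int,
    [/\ ((a - b' - c') %% 3)%Z != 0, b' ^+ 2 = b ^+ 2 & c' ^+ 2 = c ^+ 2].
  have : [|| ((a - b - c) %% 3)%Z != 0, ((a + b - c) %% 3)%Z != 0,
      ((a - b + c) %% 3)%Z != 0 | ((a + b + c) %% 3)%Z != 0] by clear -nz; lia.
  case/or4P => h; [exists b, c|exists (- b), c|exists b, (- c)|exists (- b), (- c)];
    by rewrite ?sqrrN ?opprK.
clear IH; exists (a + 2 * b' + 2 * c'), (2 * a + b' - 2 * c'), (2 * a - 2 * b' + c').
split; [by clear -nz'; lia|by clear -nz'; lia|by clear -nz'; lia|].
by rewrite N9 -ea -eb -ec; ring.
Qed.

(** * Sums of squares of integers congruent to [1] or [-1] *)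

(** Up to sign, the integers congruent to [1] or [-1] modulo [m] are the
    [m y + 1]; so [pm1_sum m k n] is the property that [n] is a sum of exactly
    [k] squares of such integers. *)
Definition pm1_sum (m k : nat) (n : int) : Prop :=
  exists ys : seq int, size ys = k /\ n = \sum_(y <- ys) (m%:Z * y + 1) ^+ 2.

Lemma residue_pm1 (m : nat) (d : int) :
  (d = 1 %[mod m])%Z \/ (d = -1 %[mod m])%Z ->
  exists (e : bool) (k : int), d = m%:Z * k + (-1) ^+ e.
Proof.
case=> /eqP; rewrite eqz_mod_dvd => /dvdzP[k e]; [exists false|exists true];
  by exists k; rewrite ?expr0 ?expr1; lia.
Qed.

Lemma pm1_sumP (m : nat) d k n :
  (d = 1 %[mod m])%Z \/ (d = -1 %[mod m])%Z ->
  pm1_sum m k n <->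
  exists xs, [/\ size xs = k, forall a, a \in xs -> residue_class d m a &
                 n = \sum_(a <- xs) a ^+ 2].
Proof.
move=> /residue_pm1[e [j ed]]; set s : int := (-1) ^+ e in ed.
have ss : s * s = 1 by rewrite /s -expr2 sqrr_sign.
split=> [[ys [<- ->]]|[xs [<- xsA ->]]].
  exists [seq s * (m%:Z * y + 1) | y <- ys]; split; first by rewrite size_map.
    move=> a /mapP[y _ ->]; exists (s * y - j) => //.
    by rewrite ed; ring.
  rewrite big_map; apply: eq_bigr => y _.
  by rewrite exprMn (expr2 s) ss mul1r.
have {xsA} : forall a, a \in xs -> exists y, a ^+ 2 = (m%:Z * y + 1) ^+ 2.
  move=> a /xsA[x _ <-]; exists (s * (x + j)).
  have -> : m%:Z * x + d = s * (m%:Z * (s * (x + j)) + 1).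
    have -> : s * (m%:Z * (s * (x + j)) + 1) = (s * s) * (m%:Z * (x + j)) + s.
      by ring.
    by rewrite ss ed; ring.
  by rewrite exprMn (expr2 s) ss mul1r.
elim: xs => [|a xs IH] h; first by exists [::]; rewrite !big_nil.
have [|ys [sz eq]] := IH; first by move=> b bx; apply: h; rewrite inE bx orbT.
have [y ey] := h a (mem_head _ _).
by exists (y :: ys); rewrite /= sz !big_cons eq ey.
Qed.

Lemma square_universal_pm1 (m : nat) d s :
  (d = 1 %[mod m])%Z \/ (d = -1 %[mod m])%Z ->
  square_universal s (residue_class d m) <->
  forall n : nat, (0 < n)%N -> exists2 k, (k <= s)%N & pm1_sum m k n.
Proof.
move=> dm; split=> [su n n0|su n n0].
  have [xs [sz xsA e]] := su n n0; exists (size xs) => //.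
  by apply/(pm1_sumP _ _ dm); exists xs.
have [k ks] := su (absz n) (ltac:(lia)); rewrite gez0_abs ?ltW //.
by move=> /(pm1_sumP _ _ dm)[xs [sz xsA e]]; exists xs; rewrite sz.
Qed.

Lemma pm1_sum_cat m k l n p :
  pm1_sum m k n -> pm1_sum m l p -> pm1_sum m (k + l) (n + p).
Proof.
by move=> [ys [<- ->]] [zs [<- ->]]; exists (ys ++ zs); rewrite size_cat big_cat.
Qed.

Lemma pm1_sum1 m (y : int) : pm1_sum m 1 ((m%:Z * y + 1) ^+ 2).
Proof. by exists [:: y]; rewrite big_seq1. Qed.

Lemma pm1_sum_ones m k : pm1_sum m k k%:Z.
Proof.
elim: k => [|k IH]; first by exists [::]; rewrite big_nil.
by have := pm1_sum_cat (pm1_sum1 m 0) IH; rewrite mulr0 add0r expr1n -PoszD.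
Qed.

Lemma pm1_sum_pad m k l n :
  (k <= l)%N -> pm1_sum m k n -> pm1_sum m l (n + (l%:Z - k%:Z)).
Proof.
move=> kl kn; have := pm1_sum_cat kn (pm1_sum_ones m (l - k)).
by rewrite subnKC // subzn.
Qed.

Lemma pm1_sum_nat m (xs : seq nat) :
  (1 < m)%N -> (forall x, x \in xs -> (x %% m = 1)%N \/ (x %% m = m.-1)%N) ->
  pm1_sum m (size xs) (\sum_(x <- xs) x ^ 2)%N.
Proof.
move=> m1; elim: xs => [|x xs IH] h; first by exists [::]; rewrite !big_nil.
rewrite big_cons PoszD -[size _]add1n; apply: pm1_sum_cat; last first.
  by apply: IH => z zx; apply: h; rewrite inE zx orbT.
have [y ey] : exists y, (x ^ 2)%N%:Z = (m%:Z * y + 1) ^+ 2.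
  have := divn_eq x m; case: (h x (mem_head _ _)) => -> ex.
    by exists (x %/ m)%N%:Z; rewrite [in LHS]ex -mulnn PoszM PoszD PoszM; ring.
  exists (- (x %/ m).+1%:Z); rewrite [in LHS]ex -mulnn PoszM PoszD PoszM.
  have -> : m.-1%:Z = m%:Z - 1 by lia.
  by rewrite -addn1 PoszD; ring.
by rewrite ey; apply: pm1_sum1.
Qed.

Lemma pm1_sum_four m (a b : int) :
  (a %% 2 = 1)%Z -> (b %% 2 = 1)%Z -> b ^+ 2 < 4 * a ->
  pm1_sum m 4 (4 + m%:Z * (m%:Z * a + 2 * b)).
Proof.
move=> a2 b2 ba; have [x [y [z [w [<- <-]]]]] := four_squares_sum a2 b2 ba.
by exists [:: x; y; z; w]; rewrite !big_cons big_nil; split=> //; ring.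
Qed.

(** The fifth term has [y = 1] or [y = -1]; it leaves the odd number [a - 1] to
    the other four. *)
Lemma pm1_sum_five m (a b : int) (e : bool) :
  (a %% 2 = 0)%Z -> (b %% 2 = 1)%Z -> b ^+ 2 < 4 * (a - 1) ->
  pm1_sum m 5 (5 + m%:Z * (m%:Z * a + 2 * (b + (-1) ^+ e))).
Proof.
move=> a2 b2 ba; have a1 : ((a - 1) %% 2 = 1)%Z by lia.
have := pm1_sum_cat (pm1_sum_four m a1 b2 ba) (pm1_sum1 m ((-1) ^+ e)).
congr (pm1_sum _ _ _); case: e; rewrite ?expr0 ?expr1; ring.
Qed.

(** A value [V] that is too small by [j] costs [j m] additional ones. *)
Lemma pm1_sum_shift m k (s j : nat) (V : int) :
  pm1_sum m k (k%:Z + m%:Z * V) -> (k <= s + j * m)%N ->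
  pm1_sum m (s + j * m) (s%:Z + m%:Z * (V + j%:Z)).
Proof.
move=> kV kl; have := pm1_sum_pad kl kV; congr (pm1_sum _ _ _).
by rewrite PoszD PoszM; ring.
Qed.

Lemma is_SU_pm1 (m : nat) d s (n0 : nat) :
  (d = 1 %[mod m])%Z \/ (d = -1 %[mod m])%Z ->
  (forall n : nat, (0 < n)%N -> exists2 k, (k <= s)%N & pm1_sum m k n) ->
  (0 < n0)%N -> (forall k, pm1_sum m k n0 -> (s <= k)%N) ->
  is_SU (residue_class d m) s.
Proof.
move=> dm up n00 low; split; first exact/square_universal_pm1.
move=> t /(square_universal_pm1 _ dm)/(_ n0 n00)[k kt /low sk].
exact: leq_trans sk kt.
Qed.

Lemma pm1_sum_mod (m : nat) p k n :
  (forall y : int, (p %| (m%:Z * y + 1) ^+ 2 - 1)%Z) ->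
  pm1_sum m k n -> (p %| n - k%:Z)%Z.
Proof.
move=> h [ys [<- ->]]; elim: ys => [|y ys IH]; first by rewrite big_nil.
rewrite big_cons /= -[(size ys).+1]addn1 PoszD; set S := \sum_(z <- ys) _ in IH *.
have -> : (m%:Z * y + 1) ^+ 2 + S - ((size ys)%:Z + 1) =
  ((m%:Z * y + 1) ^+ 2 - 1) + (S - (size ys)%:Z) by ring.
exact: rpredD.
Qed.

(** * The moduli 2, 4 and 6 *)

Lemma even_mul_succ (y : int) : exists t, y * (y + 1) = 2 * t.
Proof.
have : ((y %% 2)%Z = 0) \/ ((y %% 2)%Z = 1) by lia.
case=> h; have := divz_eq y 2; rewrite h => e.
  by exists ((y %/ 2)%Z * (y + 1)); rewrite {1}e; ring.
by exists (y * ((y %/ 2)%Z + 1)); rewrite {2}e; ring.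
Qed.

Lemma pm1_sum2_mod8 k n : pm1_sum 2 k n -> (8 %| n - k%:Z)%Z.
Proof.
apply: pm1_sum_mod => y; have [t e] := even_mul_succ y.
apply/dvdzP; exists t; transitivity (4 * (y * (y + 1))); first by ring.
by rewrite e; ring.
Qed.

Lemma pm1_sum6_mod24 k n : pm1_sum 6 k n -> (24 %| n - k%:Z)%Z.
Proof.
apply: pm1_sum_mod => y; have [t e] := even_mul_succ y.
apply/dvdzP; exists (t + y ^+ 2).
transitivity (12 * (y * (y + 1)) + 24 * y ^+ 2); first by ring.
by rewrite e; ring.
Qed.

Lemma pm1_sum3_mod3 k n : pm1_sum 3 k n -> (3 %| n - k%:Z)%Z.
Proof.
apply: pm1_sum_mod => y; apply/dvdzP; exists (3 * y ^+ 2 + 2 * y); ring.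
Qed.

Lemma pm1_sum2_of_4 k n : pm1_sum 4 k n -> pm1_sum 2 k n.
Proof.
move=> [ys [<- ->]]; exists [seq 2 * y | y <- ys]; rewrite size_map big_map.
by split=> //; apply: eq_bigr => y _; congr (_ ^+ 2); ring.
Qed.

Lemma pm1_sum_two_squares m n : pm1_sum m 2 n ->
  exists x y : nat, (x ^ 2 + y ^ 2)%N%:Z = n.
Proof.
case=> -[|a [|b [|? ?]]] [] // _ ->.
exists (absz (m%:Z * a + 1)%R), (absz (m%:Z * b + 1)%R).
rewrite !big_cons big_nil addr0 PoszD -!mulnn !PoszM -!expr2 !abszE.
by rewrite !real_normK ?num_real.
Qed.

Lemma two_squares_check (n b : nat) : (n < b ^ 2)%N ->
  all (fun x => all (fun y => x ^ 2 + y ^ 2 != n)%N (iota 0 b)) (iota 0 b) ->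
  forall x y, (x ^ 2 + y ^ 2)%N <> n.
Proof.
move=> nb /allP h x y e.
have xb : (x < b)%N by rewrite -ltn_sqr; lia.
have yb : (y < b)%N by rewrite -ltn_sqr; lia.
have /allP/(_ y) := h x (ltac:(by rewrite mem_iota)).
by rewrite mem_iota yb => /(_ isT); rewrite e eqxx.
Qed.

(** Subtracting [r < p] ones from [n >= 3] leads to the residue [3] modulo [p], where
    three squares are enough. *)
Lemma pm1_sum_residues m p :
  (3 < p)%N -> (forall N, (N %% p = 3)%N -> pm1_sum m 3 N%:Z) ->
  forall n : nat, (0 < n)%N -> exists2 k, (k <= p.+2)%N & pm1_sum m k n.
Proof.
move=> p3 h n n0; have [n3|n3] := ltnP n 3.
  by exists n; [lia|apply: pm1_sum_ones].
pose r := ((n - 3) %% p)%N.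
have rp : (r < p)%N by rewrite ltn_mod; lia.
have en : (n = (n - 3) %/ p * p + 3 + r)%N.
  by have := divn_eq (n - 3) p; rewrite -/r; lia.
exists (3 + r)%N; first by lia.
have := h ((n - 3) %/ p * p + 3)%N; rewrite modnMDl modn_small //.
move=> /(_ erefl) => h3; have := pm1_sum_pad (leq_addr r 3) h3.
by congr (pm1_sum _ _ _); rewrite [in RHS]en !PoszD; ring.
Qed.

Lemma pm1_sum_three_odd m N :
  m = 2%N \/ m = 4%N -> (N %% 8 = 3)%N -> pm1_sum m 3 N%:Z.
Proof.
move=> m24 /three_odd_squares[x [y [z [ox oy oz <-]]]].
have := @pm1_sum_nat m [:: x; y; z]; rewrite !big_cons big_nil addn0 addnA.
apply; first by case: m24 => ->.
by move=> t; rewrite !inE => /or3P[] /eqP ->; case: m24 => ->; lia.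
Qed.

Lemma is_SU_2_4 m d : m = 2%N \/ m = 4%N ->
  (d = 1 %[mod m])%Z \/ (d = -1 %[mod m])%Z -> is_SU (residue_class d m) 10.
Proof.
move=> m24 dm; apply: (is_SU_pm1 (n0 := 42) dm) => //.
  by apply: pm1_sum_residues => // N; apply: pm1_sum_three_odd.
move=> k k42; have {m24 dm} {}k42 : pm1_sum 2 k 42.
  by case: m24 k42 => -> // /pm1_sum2_of_4.
have k2 : (k != 2)%N.
  apply/eqP => k2; move: k42; rewrite k2 => /pm1_sum_two_squares[x [y [e]]].
  exact: (@two_squares_check 42 7 isT isT x y).
by have /dvdzP[q] := pm1_sum2_mod8 k42; lia.
Qed.

Lemma odd_of_sum_sqr x y z :
  ((x ^ 2 + y ^ 2 + z ^ 2) %% 8 = 3)%N -> [/\ odd x, odd y & odd z].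
Proof.
have sqr8 (t : nat) : (odd t && (t ^ 2 %% 8 == 1) ||
    ~~ odd t && ((t ^ 2 %% 8 == 0) || (t ^ 2 %% 8 == 4)))%N.
  have [ot|ot] := boolP (odd t); first by rewrite odd_sqr_mod8.
  have [j ->] : exists j, t = (2 * j)%N by exists (t %/ 2)%N; lia.
  by rewrite expnMn; move: (j ^ 2)%N => J; lia.
have := sqr8 x; have := sqr8 y; have := sqr8 z; clear sqr8.
case: (odd x); case: (odd y); case: (odd z) => //=;
  by move: (x ^ 2)%N (y ^ 2)%N (z ^ 2)%N => X Y Z; lia.
Qed.

Lemma three_squares_prime_to6 N : (N %% 24 = 3)%N ->
  exists x y z, [/\ (x %% 6 = 1)%N \/ (x %% 6 = 5)%N,
    (y %% 6 = 1)%N \/ (y %% 6 = 5)%N, (z %% 6 = 1)%N \/ (z %% 6 = 5)%N &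
    (x ^ 2 + y ^ 2 + z ^ 2 = N)%N].
Proof.
move=> N24; have N8 : (N %% 8 = 3)%N by lia.
have [x [y [z [_ _ _ e]]]] := three_odd_squares N8.
have {}e : x%:Z ^+ 2 + y%:Z ^+ 2 + z%:Z ^+ 2 = N%:Z.
  by rewrite -e !PoszD -!mulnn !PoszM !expr2.
have [N0 N3] : (0 < N)%N /\ (3 %| N)%N by clear -N24; lia.
have [a [b [c [a3 b3 c3 {}e]]]] := three_squares_prime_to3 N0 N3 e.
have {}e : (absz a ^ 2 + absz b ^ 2 + absz c ^ 2)%N = N.
  apply/eqP; rewrite -eqz_nat !PoszD -!mulnn !PoszM -!expr2 !abszE.
  by rewrite !real_normK ?num_real // e.
have [oa ob oc] := odd_of_sum_sqr (etrans (congr1 (modn^~ 8) e) N8).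
exists (absz a), (absz b), (absz c); split=> //.
- by clear -a3 oa; lia.
- by clear -b3 ob; lia.
- by clear -c3 oc; lia.
Qed.

Lemma pm1_sum6_three N : (N %% 24 = 3)%N -> pm1_sum 6 3 N%:Z.
Proof.
move=> /three_squares_prime_to6[x [y [z [hx hy hz <-]]]].
have := @pm1_sum_nat 6 [:: x; y; z]; rewrite !big_cons big_nil addn0 addnA.
by apply=> // t; rewrite !inE => /or3P[] /eqP ->.
Qed.

Lemma is_SU_6 d :
  (d = 1 %[mod 6%N])%Z \/ (d = -1 %[mod 6%N])%Z -> is_SU (residue_class d 6) 26.
Proof.
move=> dm; apply: (is_SU_pm1 (n0 := 266) dm) => //.
  by apply: pm1_sum_residues => // N; apply: pm1_sum6_three.
move=> k k266; have k2 : (k != 2)%N.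
  apply/eqP => k2; move: k266; rewrite k2 => /pm1_sum_two_squares[x [y [e]]].
  exact: (@two_squares_check 266 17 isT isT x y).
by have /dvdzP[q] := pm1_sum6_mod24 k266; lia.
Qed.

(** * Moduli at least 7 *)

(** Apart from [1], the smallest available square is [(m - 1) ^ 2]. *)
Lemma pm1_sum_below (m n k : nat) :
  (n < m.-1 ^ 2)%N -> pm1_sum m k n -> k = n.
Proof.
move=> nm [ys [<- e]]; have y0 y : y \in ys -> y = 0.
  move=> yys; have: (m%:Z * y + 1) ^+ 2 <= n%:Z.
    rewrite e (big_rem y) //= lerDl sumr_ge0 // => z _; exact: sqr_ge0.
  apply: contraTeq => y0; rewrite -ltNge.
  have : n%:Z < (m%:Z - 1) ^+ 2.
    have [m0|m0] := posnP m; first by move: nm; rewrite m0.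
    have -> : m%:Z - 1 = m.-1%:Z by lia.
    by rewrite expr2 -PoszM mulnn.
  move/lt_le_trans; apply.
  rewrite -subr_ge0; have -> : (m%:Z * y + 1) ^+ 2 - (m%:Z - 1) ^+ 2 =
     m%:Z * ((m%:Z * (y - 1) + 2) * (y + 1)) by ring.
  have [m0|m0] := posnP m; first by rewrite m0 mul0r.
  have [y1|y1] := ltP 0 y.
    by rewrite !mulr_ge0 // ?addr_ge0 ?mulr_ge0 //; lia.
  rewrite mulr_ge0 // mulr_le0 //; last by lia.
  have : m%:Z * (y - 1) <= m%:Z * - 2 by rewrite ler_pM2l //; lia.
  by lia.
have : n%:Z = \sum_(y <- ys) 1.
  by rewrite e big_seq [RHS]big_seq; apply: eq_bigr => y /y0 ->; rewrite mulr0.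
have -> : \sum_(y <- ys) 1 = (size ys)%:Z.
  by elim: {y0 e} ys => [|y ys IH]; rewrite ?big_nil // big_cons IH.
by case.
Qed.

(** By Cauchy's lemma with four terms if [q] is odd, with five terms if [q] is
    even. *)
Lemma pm1_sum_near_multiple (m q : nat) (b : int) : (0 < q)%N ->
  b \in (if odd q then [:: 1; -1] else [:: 0; 2; -2]) ->
  exists2 k : nat, (k <= 5)%N & pm1_sum m k (k%:Z + m%:Z * (m%:Z * q%:Z + 2 * b)).
Proof.
move=> q0; case: ifP => oq.
  rewrite !inE => b1; exists 4%N => //; apply: pm1_sum_four; [by lia|by lia|].
  by case/orP: b1 => /eqP ->; rewrite ?sqrrN expr1n; lia.
have q2 : 1 < 4 * (q%:Z - 1) by lia.
have qe : (q%:Z %% 2)%Z = 0 by lia.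
rewrite !inE => /or3P[] /eqP ->; exists 5%N => //.
- by have := @pm1_sum_five m q 1 true qe erefl; rewrite expr1n expr1 subrr; apply.
- by have := @pm1_sum_five m q 1 false qe erefl; rewrite expr1n expr0; apply.
by have := @pm1_sum_five m q (-1) true qe erefl; rewrite sqrrN expr1n expr1; apply.
Qed.

(** Neighbours among the numbers [m q + 2 b] of [pm1_sum_near_multiple] differ by
    [4] if they share [q] and by [m - 6] otherwise, hence by at most [m - 3].  So
    for [N >= m - 1] one of them lies between [N - (m - 3)] and [N - 1]. *)
Lemma pm1_sum_ge7_le (m n : nat) : (7 <= m)%N -> (0 < n)%N ->
  exists2 k, (k <= m ^ 2 - 2 * m)%N & pm1_sum m k n.
Proof.
move=> m7 n0.
pose N := (n.-1 %/ m)%N; pose s := (n.-1 %% m).+1.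
have en : (n = s + m * N)%N.
  by have := divn_eq n.-1 m; rewrite -/N /s mulnC; lia.
have sm : (0 < s <= m)%N by rewrite /s /= ltn_mod; lia.
have bound j : (j <= m - 3)%N -> (s + j * m <= m ^ 2 - 2 * m)%N.
  by move=> jm; nia.
clearbody N s; rewrite {n n0}en.
have [Nm|Nm] := leqP N (m - 3).
  by exists (s + N * m)%N; [exact: bound | rewrite mulnC; apply: pm1_sum_ones].
have [Nm2|Nm2] := eqVneq N (m - 2)%N.
  exists s; first by have := bound 0%N; lia.
  have /andP[s0 _] := sm; have := pm1_sum_pad s0 (pm1_sum1 m (-1)).
  congr (pm1_sum _ _ _); rewrite Nm2 PoszD PoszM -subzn; last by lia.
  by ring.
have : exists (j : nat) (q : nat) (b : int), [/\ (0 < j <= m - 3)%N, (0 < q)%N,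
    b \in (if odd q then [:: 1; -1] else [:: 0; 2; -2]) &
    N%:Z = m%:Z * q%:Z + 2 * b + j%:Z].
  pose q := (N.+1 %/ m)%N; pose r := (N.+1 %% m)%N.
  have eN : (N.+1 = q * m + r)%N := divn_eq _ _.
  have rm : (r < m)%N by rewrite ltn_mod; lia.
  have q0 : (0 < q)%N by rewrite divn_gt0; lia.
  have {}eN : N%:Z = m%:Z * q%:Z + r%:Z - 1.
    by rewrite -PoszM mulnC; move: (q * m)%N eN => qm; lia.
  (* Dividing [N + 1] rather than [N] makes [q] positive for [N = m - 1]; [b] is the
     largest one with [m q + 2 b < N]. *)
  case oq: (odd q).
    have [r4|r4] := ltnP r 4.
      exists r.+1, q, (-1); rewrite oq eN; split=> //; [by lia|].
      by rewrite -[r.+1]addn1 PoszD; ring.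
    exists (r - 3)%N, q, 1; rewrite oq eN; split=> //; [by lia|].
    by rewrite -subzn; [ring|lia].
  have [r2|r2] := ltnP r 2.
    exists (r + 3)%N, q, (-2); rewrite oq eN; split=> //; [by lia|].
    by rewrite PoszD; ring.
  have [r6|r6] := ltnP r 6.
    exists (r - 1)%N, q, 0; rewrite oq eN; split=> //; [by lia|].
    by rewrite -subzn; [ring|lia].
  exists (r - 5)%N, q, 2; rewrite oq eN; split=> //; [by lia|].
  by rewrite -subzn; [ring|lia].
move=> [j [q [b [/andP[j0 jm] q0 bq e]]]].
exists (s + j * m)%N; first exact: bound.
have [k k5 kV] := pm1_sum_near_multiple m q0 bq.
have := @pm1_sum_shift m k s j _ kV; rewrite -e PoszD PoszM; apply.
by clear -k5 j0 m7 sm; nia.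
Qed.

Lemma is_SU_ge7 (m : nat) d : (7 <= m)%N ->
  (d = 1 %[mod m])%Z \/ (d = -1 %[mod m])%Z ->
  is_SU (residue_class d m) (m ^ 2 - 2 * m)%N.
Proof.
move=> m7 dm; apply: (is_SU_pm1 (n0 := (m ^ 2 - 2 * m)%N) dm).
- by move=> n n0; apply: pm1_sum_ge7_le.
- by clear -m7; nia.
by move=> k /pm1_sum_below -> //; clear -m7; case: m m7 => // m m7 /=; nia.
Qed.

(** * The modulus 3 *)

Lemma pm1_sum3_prime_to3 (xs : seq int) :
  all (fun x => (x %% 3)%Z != 0) xs ->
  pm1_sum 3 (size xs) (\sum_(x <- xs) x ^+ 2).
Proof.
elim: xs => [|x xs IH] /=; first by move=> _; exists [::]; rewrite !big_nil.
move=> /andP[x3 /IH h]; rewrite big_cons -[(size xs).+1]add1n; apply: pm1_sum_cat => //.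
have [y ->] : exists y, x ^+ 2 = (3%N%:Z * y + 1) ^+ 2; last exact: pm1_sum1.
have [h1|h1] : (x %% 3)%Z = 1 \/ (x %% 3)%Z = 2 by lia.
  by exists (x %/ 3)%Z; rewrite {1}(divz_eq x 3) h1; ring.
by exists (- (x %/ 3)%Z - 1); rewrite {1}(divz_eq x 3) h1; ring.
Qed.

Lemma pm1_sum3P k n : pm1_sum 3 k n <->
  exists xs : seq int, [/\ size xs = k, all (fun x => (x %% 3)%Z != 0) xs &
    n = \sum_(x <- xs) x ^+ 2].
Proof.
split=> [[ys [<- ->]]|[xs [<- h ->]]]; last exact: pm1_sum3_prime_to3.
exists [seq 3%N%:Z * y + 1 | y <- ys]; rewrite size_map big_map; split=> //.
by apply/allP => _ /mapP[y _ ->]; lia.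
Qed.

(** Modulo [3], the sum and the difference of a vanishing and a nonvanishing
    residue do not vanish. *)
Lemma pm1_sum3_pairs (x y z w : int) :
  (x %% 3)%Z = 0 -> (y %% 3)%Z != 0 -> (z %% 3)%Z = 0 -> (w %% 3)%Z != 0 ->
  pm1_sum 3 4 (2 * (x ^+ 2 + y ^+ 2 + z ^+ 2 + w ^+ 2)).
Proof.
move=> hx hy hz hw; apply/pm1_sum3P.
exists [:: x + y; x - y; z + w; z - w]; rewrite !big_cons big_nil /=.
by split=> //; [lia|ring].
Qed.

Lemma pm1_sum3_four_odd (n : nat) : (4 <= n)%N -> (n %% 3 = 1)%N -> odd n ->
  pm1_sum 3 4 n.
Proof.
move=> n4 n3 on.
have [a [b [a2 b2 ba e]]] : exists a b : int, [/\ (a %% 2)%Z = 1, (b %% 2)%Z = 1,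
    b ^+ 2 < 4 * a & n%:Z = 4 + 3 * (3 * a + 2 * b)].
  pose N := ((n - 4) %/ 3)%N.
  have eN : (n = 3 * N + 4)%N by rewrite /N; lia.
  have oN : odd N by lia.
  have [h|[h|h]] : (N %% 3 = 0 \/ N %% 3 = 1 \/ N %% 3 = 2)%N by lia.
  (* [b] is such that [3] divides [N - 2 b]; for [3 %| N] the choice [b = 3] would
     miss [N = 3] and [N = 9]. *)
  - by exists ((N%:Z + 6) %/ 3)%Z, (-3); split; lia.
  - by exists ((N%:Z + 2) %/ 3)%Z, (-1); split; lia.
  - by exists ((N%:Z - 2) %/ 3)%Z, 1; split; lia.
by have := pm1_sum_four 3 a2 b2 ba; rewrite e.
Qed.

(** Cauchy's lemma with [b = 1] writes [k] as a sum of four squares, and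
    [k = 2] modulo [3] means that two of them are prime to [3] and two are not.
    Pairing each of the former with one of the latter gives [2 k]. *)
Lemma pm1_sum3_four_twice_odd (k : nat) : odd k -> (k %% 3 = 2)%N ->
  pm1_sum 3 4 (2 * k)%N.
Proof.
move=> ok k3.
have [||x [y [z [w [_ e]]]]] := @four_squares_sum k 1 _ erefl; [lia|lia|].
have -> : (2 * k)%N%:Z = 2 * (x ^+ 2 + y ^+ 2 + z ^+ 2 + w ^+ 2).
  by rewrite e PoszM.
have : ((x ^+ 2 + y ^+ 2 + z ^+ 2 + w ^+ 2) %% 3)%Z = 2 by rewrite e; lia.
clear.
pose P x y z w := pm1_sum 3 4 (2 * (x ^+ 2 + y ^+ 2 + z ^+ 2 + w ^+ 2)).
have swap12 a b c d : P a b c d -> P b a c d.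
  by rewrite /P (addrC (a ^+ 2)).
have swap23 a b c d : P a b c d -> P a c b d.
  by rewrite /P (addrAC (a ^+ 2)).
have swap34 a b c d : P a b c d -> P a b d c.
  by rewrite /P (addrAC _ (c ^+ 2)).
rewrite -/(P x y z w).
case: (sqr_mod3 x) (sqr_mod3 y) (sqr_mod3 z) (sqr_mod3 w)
  => -[hx sx] [] [hy sy] [] [hz sz] [] [hw sw] h; try (exfalso; clear -sx sy sz sw h; lia).
- by apply: swap23; apply: pm1_sum3_pairs.
- by apply: pm1_sum3_pairs.
- by apply: swap34; apply: pm1_sum3_pairs.
- by apply: swap12; apply: pm1_sum3_pairs.
- by apply: swap12; apply: swap34; apply: pm1_sum3_pairs.
- by apply: swap23; apply: swap12; apply: swap34; apply: pm1_sum3_pairs.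
Qed.

Lemma pm1_sum3_three (n : nat) : (n %% 24 = 3)%N -> pm1_sum 3 3 n.
Proof.
move=> /three_squares_prime_to6[x [y [z [hx hy hz <-]]]].
have := @pm1_sum_nat 3 [:: x; y; z]; rewrite !big_cons big_nil addn0 addnA.
apply=> // t; rewrite !inE => /or3P[] /eqP -> /=; clear -hx hy hz; lia.
Qed.

(** Odd [n] come from Cauchy's lemma, [n = 4] modulo [8] from three squares prime
    to [6] and a one, [n = 2] modulo [4] from [n / 2], and multiples of [8] from
    [n / 4] by doubling each term. *)
Lemma pm1_sum3_four (n : nat) : (4 <= n)%N -> (n %% 3 = 1)%N -> pm1_sum 3 4 n.
Proof.
elim/ltn_ind: n => n IH n4 n3.
have [on|on] := boolP (odd n); first exact: pm1_sum3_four_odd.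
have [h2|h2] := eqVneq (n %% 4)%N 2%N.
  have -> : n = (2 * (n %/ 2))%N by lia.
  by apply: pm1_sum3_four_twice_odd; clear -n3 h2; lia.
have [h4|h4] := eqVneq (n %% 8)%N 4%N.
  have h3 : ((n - 1) %% 24 = 3)%N by clear -n3 h4; lia.
  have := pm1_sum_cat (pm1_sum_ones 3 1) (pm1_sum3_three h3).
  by rewrite -PoszD subnKC //; lia.
have [l [nl l4 l3 ln]] : exists l, [/\ n = (4 * l)%N, (4 <= l)%N, (l %% 3 = 1)%N & (l < n)%N].
  by exists (n %/ 4)%N; clear -n4 n3 on h2 h4; split; lia.
have /pm1_sum3P[xs [sz h e]] := IH l ln l4 l3; apply/pm1_sum3P.
exists [seq 2 * x | x <- xs]; rewrite size_map big_map; split=> //.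
  by rewrite all_map; apply: sub_all h => x /=; lia.
rewrite nl PoszM e big_distrr /=; apply: eq_bigr => x _; ring.
Qed.

Lemma three_squares_15 (x y z : nat) : (x ^ 2 + y ^ 2 + z ^ 2)%N <> 15%N.
Proof.
move=> e; have bound (t : nat) : (t ^ 2 <= 15)%N -> (t < 4)%N.
  by move=> t15; rewrite -ltn_sqr; lia.
have [bx b_y bz] : [/\ x < 4, y < 4 & z < 4]%N by split; apply: bound; lia.
move: x y z bx b_y bz e.
by do 3 case=> [|[|[|[|//]]]].
Qed.

Lemma is_SU_3 d :
  (d = 1 %[mod 3%N])%Z \/ (d = -1 %[mod 3%N])%Z -> is_SU (residue_class d 3) 6.
Proof.
move=> dm; apply: (is_SU_pm1 (n0 := 15) dm) => // [n n0|k k15].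
  have [n3|n3] := leqP n 3; first by exists n; [lia|apply: pm1_sum_ones].
  have : exists r, [/\ (r <= 2)%N, (4 <= n - r)%N, (r <= n)%N & ((n - r) %% 3 = 1)%N].
    by exists ((n - 1) %% 3)%N; split; lia.
  move=> [r [r2 nr4 rn nr3]]; exists (4 + r)%N; first by lia.
  have := pm1_sum_cat (pm1_sum3_four nr4 nr3) (pm1_sum_ones 3 r).
  by rewrite -PoszD subnK.
have k3 : (k != 3)%N.
  apply/eqP => k3; move: k15; rewrite k3 => -[[|a [|b [|c [|? ?]]]] [] // _].
  rewrite !big_cons big_nil addr0 addrA => e.
  apply: (@three_squares_15 (absz (3%N%:Z * a + 1)%R) (absz (3%N%:Z * b + 1)%R)
    (absz (3%N%:Z * c + 1)%R)).
  apply/eqP; rewrite -eqz_nat !PoszD -!mulnn !PoszM -!expr2 !abszE.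
  by rewrite !real_normK ?num_real // -e.
have k0 : (k != 0)%N.
  apply/eqP => k0; move: k15; rewrite k0 => -[[|? ?] [] // _].
  by rewrite big_nil.
by have /dvdzP[q] := pm1_sum3_mod3 k15; lia.
Qed.

(** * The modulus 5 *)

Lemma pm1_sum5_four (N : nat) : odd N -> (45 <= N)%N ->
  pm1_sum 5 4 (4 + 5%N%:Z * N%:Z).
Proof.
move=> oN N45.
have [a [b [a2 b2 ba e]]] : exists a b : int, [/\ (a %% 2)%Z = 1, (b %% 2)%Z = 1,
    b ^+ 2 < 4 * a & N%:Z = 5 * a + 2 * b].
  (* [b] is such that [5] divides [N - 2 b]; as [b ^ 2 <= 25], the bound [45]
     makes [a >= 7] large enough. *)
  have [h|[h|[h|[h|h]]]] : ((N %% 5 = 0) \/ (N %% 5 = 1) \/ (N %% 5 = 2) \/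
      (N %% 5 = 3) \/ (N %% 5 = 4))%N by lia.
  - by exists ((N%:Z - 10) %/ 5)%Z, 5; split; lia.
  - by exists ((N%:Z - 6) %/ 5)%Z, 3; split; lia.
  - by exists ((N%:Z - 2) %/ 5)%Z, 1; split; lia.
  - by exists ((N%:Z + 2) %/ 5)%Z, (-1); split; lia.
  - by exists ((N%:Z + 6) %/ 5)%Z, (-3); split; lia.
by have := pm1_sum_four 5 a2 b2 ba; rewrite e.
Qed.

Fixpoint multisets_upto (l : seq nat) : nat -> seq (seq nat) :=
  if l is x :: l' then
    fix with_x k :=
      multisets_upto l' k ++ (if k is k'.+1 then map (cons x) (with_x k') else [::])
  else fun _ => [:: [::]].

Definition sumsq (xs : seq nat) : nat := foldr (fun x s => x ^ 2 + s)%N 0%N xs.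

Lemma mem_multisets_upto l k xs x : xs \in multisets_upto l k -> x \in xs -> x \in l.
Proof.
elim: l k xs => [|y l IH] k xs; first by rewrite inE => /eqP ->.
elim: k xs => [|k IHk] xs; rewrite mem_cat.
  by rewrite orbF => /IH h /h; rewrite inE orbC => ->.
case/orP=> [/IH h /h|/mapP[ys ysk ->]]; first by rewrite !inE orbC => ->.
by rewrite !inE => /orP[->//|]; rewrite -in_cons; apply: IHk.
Qed.

Lemma small_sums_mod5 : all (fun n =>
  has (fun xs => let s := sumsq xs in (s <= n) && (size xs + (n - s) <= 16))
    (multisets_upto [:: 4; 6; 9; 11; 14] 4))%N (iota 1 240).
Proof. by vm_compute. Qed.

Lemma pm1_sum5_le16 (n : nat) : (0 < n)%N ->
  exists2 k, (k <= 16)%N & pm1_sum 5 k n.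
Proof.
move=> n0; have [n240|n240] := leqP n 240.
  have /(allP small_sums_mod5)/hasP[xs xsM /= /andP[sn k16]] : n \in iota 1 240.
    by rewrite mem_iota; lia.
  exists (size xs + (n - sumsq xs))%N => //.
  have -> : n%:Z = (sumsq xs)%:Z + (n - sumsq xs)%N%:Z by rewrite -PoszD subnKC.
  apply: pm1_sum_cat; last exact: pm1_sum_ones.
  have -> : sumsq xs = (\sum_(x <- xs) x ^ 2)%N by rewrite unlock.
  apply: pm1_sum_nat => // x /(mem_multisets_upto xsM).
  by rewrite !inE => /or4P[|||/orP[]] /eqP ->; [right|left|right|left|right].
pose N := (n.-1 %/ 5)%N; pose s := (n.-1 %% 5).+1.
have [j [j12 oN N45]] : exists j, [/\ (1 <= j <= 2)%N, odd (N - j) & (45 <= N - j)%N].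
  by exists (if odd N then 2 else 1)%N; rewrite /N; case: ifP; split; lia.
have e : n%:Z = s%:Z + 5%N%:Z * ((N - j)%N%:Z + j%:Z).
  by rewrite /s /N in N45 *; lia.
exists (s + j * 5)%N; first by rewrite /s; lia.
by rewrite e; apply: pm1_sum_shift (pm1_sum5_four oN N45) _; rewrite /s; lia.
Qed.

(** Only the squares [1] and [16] do not exceed [31], so [31 = k + 15 c] for the
    number [c <= k] of terms equal to [16]. *)
Lemma pm1_sum5_31 k : pm1_sum 5 k 31 -> (16 <= k)%N.
Proof.
move=> [ys [<- e]].
have sq y : y \in ys -> (5%N%:Z * y + 1) ^+ 2 = 1 + 15 * (y == -1)%:Z.
  move=> yys; have : (5%N%:Z * y + 1) ^+ 2 <= 31.
    rewrite e (big_rem y) //= lerDl sumr_ge0 // => z _; exact: sqr_ge0.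
  have [->|y1] := eqVneq y (-1); first by [].
  have [->|y0] := eqVneq y 0; first by [].
  by rewrite expr2; nia.
have : 31 = \sum_(y <- ys) (1 + 15 * (y == -1)%:Z).
  by rewrite e big_seq [RHS]big_seq; apply: eq_bigr => y /sq.
have -> : \sum_(y <- ys) (1 + 15 * (y == -1)%:Z) =
    (size ys)%:Z + 15 * (count_mem (-1 : int) ys)%:Z.
  elim: (ys) => [|y zs IH]; first by rewrite big_nil.
  by rewrite big_cons IH /= PoszD; lia.
by move: (count_size (pred1 (-1 : int)) ys); move: (count _ ys) (size ys); lia.
Qed.

Lemma is_SU_5 d :
  (d = 1 %[mod 5%N])%Z \/ (d = -1 %[mod 5%N])%Z -> is_SU (residue_class d 5) 16.
Proof.
move=> dm; apply: (is_SU_pm1 (n0 := 31) dm) => //; last exact: pm1_sum5_31.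
exact: pm1_sum5_le16.
Qed.

(** * The theorem *)

Lemma pm1_of_universal (m : nat) d s :
  square_universal s (residue_class d m) ->
  (d = 1 %[mod m])%Z \/ (d = -1 %[mod m])%Z.
Proof.
move=> /(_ 1 isT)[xs [_ xsA e]].
have [a axs a0] : exists2 a, a \in xs & a != 0.
  apply/hasP; apply: contraTT isT; rewrite -all_predC => /allP h.
  move: e; rewrite big_seq big1 // => a /h /negPn/eqP ->.
  by rewrite expr0n.
have a1 : a ^+ 2 <= 1.
  rewrite e (big_rem a) //= lerDl sumr_ge0 // => z _; exact: sqr_ge0.
have [x _ ea] := xsA a axs.
have : a = 1 \/ a = -1 by rewrite expr2 in a1; nia.
by case=> a_pm; [left|right]; rewrite -a_pm -ea mulrC modzMDl.
Qed.

Lemma square_universal_int d : square_universal 10 (residue_class d 1).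
Proof.
have d1 : (d = 1 %[mod 1%N])%Z \/ (d = -1 %[mod 1%N])%Z by left; rewrite !modz1.
apply/(square_universal_pm1 _ d1) => n n0.
have [k k10 [ys [sz e]]] : exists2 k, (k <= 10)%N & pm1_sum 2 k n.
  by apply: (@pm1_sum_residues 2 8) => // N; apply: pm1_sum_three_odd; left.
exists k => //; exists [seq 2 * y | y <- ys]; rewrite size_map big_map; split=> //.
by rewrite e; apply: eq_bigr => y _; congr (_ ^+ 2); ring.
Qed.

Theorem theorem1p2 (m : nat) (d : int) (hm : (0 < m)%N) :
  ((exists s : nat, square_universal s (residue_class d m)) <->
     ((d = 1 %[mod m])%Z \/ (d = -1 %[mod m])%Z)) /\
  ((2 <= m)%N ->
   ((d = 1 %[mod m])%Z \/ (d = -1 %[mod m])%Z) ->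
   [/\ (m = 2%N \/ m = 4%N -> is_SU (residue_class d m) 10),
       (m = 3%N -> is_SU (residue_class d m) 6),
       (m = 5%N -> is_SU (residue_class d m) 16),
       (m = 6%N -> is_SU (residue_class d m) 26) &
       ((7 <= m)%N -> is_SU (residue_class d m) (m ^ 2 - 2 * m)%N)]).
Proof.
have SU : (d = 1 %[mod m])%Z \/ (d = -1 %[mod m])%Z ->
   [/\ (m = 2%N \/ m = 4%N -> is_SU (residue_class d m) 10),
       (m = 3%N -> is_SU (residue_class d m) 6),
       (m = 5%N -> is_SU (residue_class d m) 16),
       (m = 6%N -> is_SU (residue_class d m) 26) &
       ((7 <= m)%N -> is_SU (residue_class d m) (m ^ 2 - 2 * m)%N)].
  move=> dm; split=> [m24|m3|m5|m6|m7].
  - exact: is_SU_2_4.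
  - by rewrite m3 in dm *; apply: is_SU_3.
  - by rewrite m5 in dm *; apply: is_SU_5.
  - by rewrite m6 in dm *; apply: is_SU_6.
  - exact: is_SU_ge7.
split=> //; split=> [[s]|dm]; first exact: pm1_of_universal.
have [m1|m1] := eqVneq m 1%N; first by exists 10%N; rewrite m1; apply: square_universal_int.
have [h24 h3 h5 h6 h7] := SU dm.
have : [\/ m = 2%N \/ m = 4%N, m = 3%N, m = 5%N | m = 6%N] \/ (7 <= m)%N.
  move: m hm m1 {dm SU h24 h3 h5 h6 h7} => [|[|[|[|[|[|[|m]]]]]]] // _ _; last by right.
  - by left; constructor 1; left.
  - by left; constructor 2.
  - by left; constructor 1; right.
  - by left; constructor 3.
  - by left; constructor 4.
case=> [[/h24[su _]|/h3[su _]|/h5[su _]|/h6[su _]]|/h7[su _]].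
- by exists 10%N.
- by exists 6%N.
- by exists 16%N.
- by exists 26%N.
- by exists (m ^ 2 - 2 * m)%N.
Qed.
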